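(* Let $\mathbb{F} \in \{\mathbb{R}, \mathbb{C}, \mathbb{H}\}$ and let $k \geqslant 1$ be an integer. Then the metric space $\mathcal{S}_k(\mathbb{F})$ of norms on $\mathbb{F}^k$ up to positive scaling is (up to isometry) a complete, path-connected metric subspace of a real Banach space. It is a singleton set if $k=1$, and it is unbounded (as a metric space) if $k>1$.
   Context: $\mathbb{F}$ is the real numbers, the complex numbers or the quaternions; $|\alpha| = \sqrt{\alpha\alpha^*}$ is the usual absolute value on $\mathbb{F}$, where $\alpha^*$ is the usual conjugate. A norm on $\mathbb{F}^k$ is a function $N : \mathbb{F}^k \to \mathbb{R}$ such that for all $\mathbf{x},\mathbf{y} \in \mathbb{F}^k$ and $\alpha \in \mathbb{F}$: $N(\mathbf{x}) \geqslant 0$ with equality if and only if $\mathbf{x}=0$; $N(\alpha \mathbf{x}) = |\alpha| N(\mathbf{x})$; and $N(\mathbf{x}+\mathbf{y}) \leqslant N(\mathbf{x}) + N(\mathbf{y})$. Let $\mathcal{N}(\mathbb{F}^k)$ be the set of all norms on $\mathbb{F}^k$. Two norms $N,N'$ are equivalent, $N \sim N'$, if $N' = \alpha N$ for some real $\alpha>0$; put $\mathcal{S}_k(\mathbb{F}) = \mathcal{N}(\mathbb{F}^k)/\sim$. It carries the metric $$d_{\mathcal{S}_k(\mathbb{F})}([N],[N']) = \log\left( M_{N,N'}/m_{N,N'}\right), \quad M_{N,N'} = \sup_{\mathbf{x} \neq 0} \frac{N'(\mathbf{x})}{N(\mathbf{x})}, \quad m_{N,N'} = \inf_{\mathbf{x}\neq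 0} \frac{N'(\mathbf{x})}{N(\mathbf{x})},$$ where $0 < m_{N,N'} \leqslant M_{N,N'} < \infty$ since all norms on $\mathbb{F}^k$ are Lipschitz equivalent. *)

(* Defs.v *)
From HB Require Import structures.
From mathcomp Require Import all_boot all_order all_algebra generic_quotient.
From mathcomp Require Import complex.
From mathcomp Require Import all_classical all_reals all_analysis.
From mathcomp Require Import ring lra.

Set Implicit Arguments.
Unset Strict Implicit.
Unset Printing Implicit Defensive.

Import Order.TTheory GRing.Theory Num.Theory.
Import numFieldNormedType.Exports.

Local Open Scope classical_set_scope.
Local Open Scope ring_scope.
Local Open Scope quotient_scope.

Record quaternion (R : Type) : Type := Quaternion {
  quat_re : R; quat_i : R; quat_j : R; quat_k : R
}.

Section QuaternionRing.
Variable R : comNzRingType.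

Implicit Types x y z : quaternion R.

Definition quat_to_tuple (x : quaternion R) :=
  (quat_re x, quat_i x, quat_j x, quat_k x).
Definition quat_of_tuple (t : R * R * R * R) :=
  let: (a, b, c, d) := t in Quaternion a b c d.
Lemma quat_to_tupleK : cancel quat_to_tuple quat_of_tuple.
Proof. by case. Qed.

HB.instance Definition _ := Choice.copy (quaternion R) (can_type quat_to_tupleK).

Definition quat_add x y := Quaternion (quat_re x + quat_re y)
  (quat_i x + quat_i y) (quat_j x + quat_j y) (quat_k x + quat_k y).
Definition quat_opp x :=
  Quaternion (- quat_re x) (- quat_i x) (- quat_j x) (- quat_k x).
Definition quat_zero : quaternion R := Quaternion 0 0 0 0.

Lemma quat_addA : associative quat_add.
Proof. by move=> [? ? ? ?] [? ? ? ?] [? ? ? ?]; rewrite /quat_add /= !addrA. Qed.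
Lemma quat_addC : commutative quat_add.
Proof.
by move=> [a b c d] [? ? ? ?]; rewrite /quat_add /= (addrC a) (addrC b) (addrC c)
  (addrC d).
Qed.
Lemma quat_add0 : left_id quat_zero quat_add.
Proof. by move=> [? ? ? ?]; rewrite /quat_add /= !add0r. Qed.
Lemma quat_addN : left_inverse quat_zero quat_opp quat_add.
Proof. by move=> [? ? ? ?]; rewrite /quat_add /= !addNr. Qed.

HB.instance Definition _ := GRing.isZmodule.Build (quaternion R)
  quat_addA quat_addC quat_add0 quat_addN.

Definition quat_one : quaternion R := Quaternion 1 0 0 0.
(* Hamilton's product, from i^2 = j^2 = k^2 = ijk = -1. *)
Definition quat_mul x y :=
  let: Quaternion a b c d := x in let: Quaternion a' b' c' d' := y in
  Quaternion (a * a' - b * b' - c * c' - d * d')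
             (a * b' + b * a' + c * d' - d * c')
             (a * c' - b * d' + c * a' + d * b')
             (a * d' + b * c' - c * b' + d * a').

Lemma quat_mulA : associative quat_mul.
Proof. by move=> [? ? ? ?] [? ? ? ?] [? ? ? ?]; congr Quaternion; ring. Qed.
Lemma quat_mul1q : left_id quat_one quat_mul.
Proof. by move=> [? ? ? ?]; congr Quaternion; ring. Qed.
Lemma quat_mulq1 : right_id quat_one quat_mul.
Proof. by move=> [? ? ? ?]; congr Quaternion; ring. Qed.
Lemma quat_mulDl : left_distributive quat_mul quat_add.
Proof. by move=> [? ? ? ?] [? ? ? ?] [? ? ? ?]; congr Quaternion => /=; ring. Qed.
Lemma quat_mulDr : right_distributive quat_mul quat_add.
Proof. by move=> [? ? ? ?] [? ? ? ?] [? ? ? ?]; congr Quaternion => /=; ring. Qed.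
Lemma quat_oneN0 : quat_one != quat_zero.
Proof. by apply/eqP => -[/eqP]; rewrite oner_eq0. Qed.

HB.instance Definition _ := GRing.Zmodule_isNzRing.Build (quaternion R)
  quat_mulA quat_mul1q quat_mulq1 quat_mulDl quat_mulDr quat_oneN0.

Definition quat_conj x :=
  Quaternion (quat_re x) (- quat_i x) (- quat_j x) (- quat_k x).

End QuaternionRing.

(* [F : scalar_kind] selects one of R, C, H, with [scalar R F] the corresponding
   division ring; the real numbers themselves are the given [R : realType]. *)
Variant scalar_kind := RealScalars | ComplexScalars | QuaternionScalars.

Definition scalar (R : realType) (F : scalar_kind) : nzRingType :=
  match F with
  | RealScalars => R : nzRingType
  | ComplexScalars => R[i] : nzRingType
  | QuaternionScalars => quaternion R : nzRingType
  end.

Definition scalar_conj (R : realType) (F : scalar_kind) :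
    scalar R F -> scalar R F :=
  match F with
  | RealScalars => fun a => a
  | ComplexScalars => @conjc R
  | QuaternionScalars => @quat_conj R
  end.

Definition scalar_re (R : realType) (F : scalar_kind) : scalar R F -> R :=
  match F with
  | RealScalars => fun a => a
  | ComplexScalars => @complex.Re R
  | QuaternionScalars => @quat_re R
  end.

(* [a * scalar_conj a] is a real scalar; [scalar_re] only reads it off in [R]. *)
Definition scalar_abs (R : realType) (F : scalar_kind) (a : scalar R F) : R :=
  Num.sqrt (scalar_re (a * scalar_conj a)).

Section Norms.
Variables (R : realType) (F : scalar_kind) (k : nat).

(* [a *: x] is left multiplication of the coordinates of [x] by [a]. *)
Record norm_on : Type := NormOn {
  norm_fun :> 'rV[scalar R F]_k -> R;
  norm_on_ge0 : forall x, 0 <= norm_fun x;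
  norm_on_eq0 : forall x, norm_fun x = 0 <-> x = 0;
  norm_onZ : forall (a : scalar R F) x,
    norm_fun (a *: x) = scalar_abs a * norm_fun x;
  norm_onD : forall x y, norm_fun (x + y) <= norm_fun x + norm_fun y
}.

HB.instance Definition _ := gen_eqMixin norm_on.
HB.instance Definition _ := gen_choiceMixin norm_on.

Definition norm_equiv (N N' : norm_on) : bool :=
  `[< exists2 a : R, 0 < a & forall x, N' x = a * N x >].

Lemma norm_equiv_refl : reflexive norm_equiv.
Proof. by move=> N; apply/asboolP; exists 1 => // x; rewrite mul1r. Qed.

Lemma norm_equiv_sym : symmetric norm_equiv.
Proof.
suff H N N' : norm_equiv N N' -> norm_equiv N' N.
  by move=> N N'; apply/idP/idP; exact: H.
move=> /asboolP[a a0 e]; apply/asboolP; exists a^-1; first by rewrite invr_gt0.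
by move=> x; rewrite e mulKf// gt_eqF.
Qed.

Lemma norm_equiv_trans : transitive norm_equiv.
Proof.
move=> N2 N1 N3 /asboolP[a a0 e] /asboolP[b b0 e']; apply/asboolP.
by exists (b * a); [rewrite mulr_gt0|move=> x; rewrite e' e mulrA].
Qed.

Canonical norm_equiv_rel :=
  EquivRel norm_equiv norm_equiv_refl norm_equiv_sym norm_equiv_trans.

Definition norm_space : Type := {eq_quot norm_equiv_rel}.
HB.instance Definition _ := Choice.on norm_space.
HB.instance Definition _ := Quotient.on norm_space.

Definition norm_ratios (N N' : norm_on) : set R :=
  [set N' x / N x | x in [set x | x != 0]].

(* [sup] and [inf] take values in [R]; they are the true bounds because
   [norm_ratios N N'] is bounded, and nonempty for 0 < k: see [norm_ratios_ub],
   [norm_ratios_lb] and [norm_on_comparable] below. *)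
Definition norm_dist (N N' : norm_on) : R :=
  ln (sup (norm_ratios N N') / inf (norm_ratios N N')).

End Norms.

Lemma rV_seminorm_upper_bound (R : realType) n (q : 'rV[R]_n -> R) :
  (forall x y, q (x + y) <= q x + q y) ->
  (forall (a : R) x, q (a *: x) = `|a| * q x) ->
  (forall x, 0 <= q x) ->
  exists2 B, 0 <= B & forall x, q x <= B * `|x|.
Proof.
move=> qD qZ q_ge0; exists (\sum_(i < n) q (delta_mx 0 i)) => [|x].
  exact: sumr_ge0.
rewrite [in leLHS](row_sum_delta x) mulr_suml.
apply: (@le_trans _ _ (\sum_(i < n) q (x 0 i *: delta_mx 0 i))).
  elim/big_ind2 : _ => //; first by rewrite -(scale0r 0) qZ normr0 mul0r.
  by move=> a b c d ab cd; exact: (le_trans (qD _ _) (lerD ab cd)).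
apply: ler_sum => i _; rewrite qZ mulrC ler_wpM2l//.
rewrite [leRHS]/Num.Def.normr/= mx_normrE.
by apply/bigmax_geP; right => /=; exists (0, i).
Qed.

Lemma rV_norm_lower_bound (R : realType) n (q : 'rV[R]_n -> R) :
  (forall x y, q (x + y) <= q x + q y) ->
  (forall (a : R) x, q (a *: x) = `|a| * q x) ->
  (forall x, q x = 0 -> x = 0) ->
  exists2 C, 0 < C & forall x, `|x| <= C * q x.
Proof.
move=> qD qZ q_eq0.
have q0 : q 0 = 0 by rewrite -(scale0r 0) qZ normr0 mul0r.
have qN x : q (- x) = q x by rewrite -scaleN1r qZ normrN1 mul1r.
have q_ge0 x : 0 <= q x.
  have := qD x (- x); rewrite subrr q0 qN; lra.
have [B B_ge0 qB] := rV_seminorm_upper_bound qD qZ q_ge0.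
have qL x y : `|q x - q y| <= B * `|x - y|.
  apply: le_trans (qB _); rewrite ler_norml.
  have := qD (x - y) y; rewrite subrK => H1.
  have := qD (y - x) x; rewrite subrK -opprB qN => H2.
  by apply/andP; split; lra.
have qC : continuous q.
  move=> x; apply/(@cvgrPdist_le _ _ _ _ (nbhs_filter x)) => e e0.
  have B1 : 0 < B + 1 by lra.
  have eB : 0 < e / (B + 1) by apply: divr_gt0.
  near=> y.
  apply: (le_trans (qL x y)).
  have xy : `|x - y| <= e / (B + 1).
    near: y; apply/nbhs_ballP; exists (e / (B + 1)) => //.
    by move=> y /=; rewrite -ball_normE => /ltW.
  apply: (@le_trans _ _ ((B + 1) * `|x - y|)); first by rewrite ler_wpM2r// lerDl.
  by rewrite mulrC -ler_pdivlMr.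
pose S := [set x : 'rV[R]_n | `|x| = 1].
have SP x : x != 0 -> S (`|x|^-1 *: x).
  by move=> x0; rewrite /S/= normrZ normfV normr_id mulVf// normr_eq0.
have [S0|/nonemptyPn S0] := pselect (S !=set0); last first.
  exists 1 => // x; have [->|x0] := eqVneq x 0; first by rewrite normr0 q0 mulr0.
  by have := SP _ x0; rewrite S0.
have cS : compact S.
  apply: bounded_closed_compact.
    exists 1; split; first exact: num_real.
    by move=> e e1 x /= ->; exact: ltW.
  rewrite (_ : S = Num.norm @^-1` [set 1]); last by apply/seteqP; split.
  apply: closed_comp => [x _|]; first exact: norm_continuous.
  exact: closed_eq.
have [c cS' qc] := @EVT_min_rV R n q S S0 cS (continuous_subspaceT qC).
have qc0 : 0 < q c.
  rewrite lt_neqAle q_ge0 andbT eq_sym; apply/eqP => /q_eq0 c0.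
  by move: cS'; rewrite inE /S/= c0 normr0 => /eqP; rewrite eq_sym oner_eq0.
exists (q c)^-1; first by rewrite invr_gt0.
move=> x; have [->|x0] := eqVneq x 0; first by rewrite normr0 q0 mulr0.
rewrite mulrC ler_pdivlMr//.
have /mem_set/qc := SP _ x0; rewrite qZ normfV normr_id mulrC.
by rewrite ler_pdivlMr ?normr_gt0// mulrC.
Unshelve. all: by end_near. Qed.

(* Real coordinates on the scalars: they reduce the equivalence of norms on F^k
   to the compactness of the unit sphere of R^n. *)
Definition real_dim (F : scalar_kind) : nat :=
  match F with
  | RealScalars => 1 | ComplexScalars => 2 | QuaternionScalars => 4
  end.

Definition of_coords (R : realType) (F : scalar_kind) :
    'rV[R]_(real_dim F) -> scalar R F :=
  match F return 'rV[R]_(real_dim F) -> scalar R F with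
  | RealScalars => fun v => v 0 ord0
  | ComplexScalars => fun v => Complex (v 0 ord0) (v 0 (lift ord0 ord0))
  | QuaternionScalars => fun v => Quaternion (v 0 ord0) (v 0 (lift ord0 ord0))
      (v 0 (lift ord0 (lift ord0 ord0))) (v 0 ord_max)
  end.

Definition of_real (R : realType) (F : scalar_kind) : R -> scalar R F :=
  match F return R -> scalar R F with
  | RealScalars => fun t => t
  | ComplexScalars => fun t => Complex t 0
  | QuaternionScalars => fun t => Quaternion t 0 0 0
  end.
Arguments of_real {R F}.

Lemma of_coordsD (R : realType) (F : scalar_kind) (u v : 'rV[R]_(real_dim F)) :
  of_coords (u + v) = of_coords u + of_coords v.
Proof. by case: F u v => u v /=; rewrite !mxE. Qed.

Lemma of_coordsZ (R : realType) (F : scalar_kind) t (v : 'rV[R]_(real_dim F)) :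
  of_coords (t *: v) = of_real t * of_coords v.
Proof.
case: F v => v /=; rewrite !mxE//; first by apply/eqP; rewrite eq_complex /=;
  apply/andP; split; apply/eqP; ring.
by congr Quaternion; ring.
Qed.

Lemma scalar_abs_of_real (R : realType) (F : scalar_kind) (t : R) :
  scalar_abs (of_real t : scalar R F) = `|t|.
Proof.
rewrite /scalar_abs -sqrtr_sqr; congr Num.sqrt.
by case: F => /=; rewrite expr2 ?mulr0 ?oppr0 ?mulr0 ?subr0.
Qed.

Lemma of_coords_eq0 (R : realType) (F : scalar_kind) (v : 'rV[R]_(real_dim F)) :
  of_coords v = 0 -> v = 0.
Proof.
case: F v => v /=.
- by move=> v0; apply/rowP => i; rewrite mxE (ord1 i).
- case=> v0 v1; apply/rowP => -[[|[|]]//= i]; rewrite mxE.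
  + by rewrite -[RHS]v0; congr (v 0 _); exact: val_inj.
  + by rewrite -[RHS]v1; congr (v 0 _); exact: val_inj.
- case=> v0 v1 v2 v3; apply/rowP => -[[|[|[|[|]]]]//= i]; rewrite mxE.
  + by rewrite -[RHS]v0; congr (v 0 _); exact: val_inj.
  + by rewrite -[RHS]v1; congr (v 0 _); exact: val_inj.
  + by rewrite -[RHS]v2; congr (v 0 _); exact: val_inj.
  + by rewrite -[RHS]v3; congr (v 0 _); exact: val_inj.
Qed.

Lemma of_coords_surj (R : realType) (F : scalar_kind) (a : scalar R F) :
  exists v : 'rV[R]_(real_dim F), of_coords v = a.
Proof.
case: F a => /= [a|[a b]|[a b c d]].
- by exists (\row_i a); rewrite mxE.
- by exists (\row_i [:: a; b]`_i); rewrite !mxE.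
- by exists (\row_i [:: a; b; c; d]`_i); rewrite !mxE.
Qed.

Section NormDist.
Variables (R : realType) (F : scalar_kind) (k : nat).
Implicit Types N : norm_on R F k.

Let rowR (v : 'rV[R]_(k * real_dim F)) : 'rV[scalar R F]_k :=
  \row_j of_coords (row j (vec_mx v)).

Let rowRD u v : rowR (u + v) = rowR u + rowR v.
Proof. by apply/rowP => j; rewrite !mxE !linearD of_coordsD. Qed.

Let rowRZ t v : rowR (t *: v) = of_real t *: rowR v.
Proof. by apply/rowP => j; rewrite !mxE !linearZ of_coordsZ. Qed.

Let rowR_eq0 v : rowR v = 0 -> v = 0.
Proof.
move=> v0; rewrite -[v]vec_mxK (_ : vec_mx v = 0) ?linear0//.
apply/row_matrixP => j; rewrite row0; apply: of_coords_eq0.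
by have /rowP/(_ j) := v0; rewrite !mxE.
Qed.

Let rowR_surj x : exists v, rowR v = x.
Proof.
have /choice[c cx] j := of_coords_surj (x 0 j).
exists (mxvec (\matrix_j c j)); apply/rowP => j.
by rewrite !mxE mxvecK rowK cx.
Qed.

Lemma norm_on_comparable N N' :
  exists2 C, 0 < C & forall x, N' x <= C * N x.
Proof.
have qD N0 u v : N0 (rowR (u + v)) <= N0 (rowR u) + N0 (rowR v).
  by rewrite rowRD norm_onD.
have qZ N0 t u : N0 (rowR (t *: u)) = `|t| * N0 (rowR u).
  by rewrite rowRZ norm_onZ scalar_abs_of_real.
have q0 N0 u : N0 (rowR u) = 0 -> u = 0 by move/norm_on_eq0/rowR_eq0.
have qge0 N0 u : 0 <= N0 (rowR u) by exact: norm_on_ge0.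
have [C C0 NC] := rV_norm_lower_bound (qD N) (qZ N) (q0 N).
have [B B0 NB] := rV_seminorm_upper_bound (qD N') (qZ N') (qge0 N').
exists (B * C + 1); first by rewrite ltr_wpDl// mulr_ge0// ltW.
move=> x; have [v <-] := rowR_surj x.
apply: (le_trans (NB v)); apply: (@le_trans _ _ (B * (C * N (rowR v)))).
  by rewrite ler_wpM2l.
by rewrite mulrA ler_wpM2r// lerDl.
Qed.

Lemma norm_on_gt0 N x : x != 0 -> 0 < N x.
Proof.
move=> x0; rewrite lt_neqAle norm_on_ge0 andbT eq_sym.
by apply: contra_neq x0 => /norm_on_eq0.
Qed.

Lemma norm_on0 N : N 0 = 0.
Proof. exact/norm_on_eq0. Qed.

Lemma norm_ratios_ub N N' : has_ubound (norm_ratios N N').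
Proof.
have [C C0 NC] := norm_on_comparable N N'; exists C => _ /= [x /= x0 <-].
by rewrite ler_pdivrMr ?norm_on_gt0.
Qed.

Lemma norm_ratios_lb N N' : has_lbound (norm_ratios N N').
Proof. by exists 0 => _ /= [x /= x0 <-]; rewrite divr_ge0 ?norm_on_ge0. Qed.

Lemma norm_le_sup N N' x : N' x <= sup (norm_ratios N N') * N x.
Proof.
have [->|x0] := eqVneq x 0; first by rewrite !norm_on0 mulr0.
rewrite -ler_pdivrMr ?norm_on_gt0//; apply: ub_le_sup; last by exists x.
exact: norm_ratios_ub.
Qed.

Lemma norm_ge_inf N N' x : inf (norm_ratios N N') * N x <= N' x.
Proof.
have [->|x0] := eqVneq x 0; first by rewrite !norm_on0 mulr0.
rewrite -ler_pdivlMr ?norm_on_gt0//; apply: ge_inf; last by exists x.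
exact: norm_ratios_lb.
Qed.

Section PositiveDimension.
Hypothesis k_gt0 : (0 < k)%N.

Let u : 'rV[scalar R F]_k := const_mx 1.

Let u_neq0 : u != 0.
Proof.
apply/eqP => /rowP/(_ (Ordinal k_gt0)); rewrite !mxE => /eqP.
by rewrite oner_eq0.
Qed.

Let norm_ratios_neq0 N N' : norm_ratios N N' !=set0.
Proof. by exists (N' u / N u), u. Qed.

Lemma sup_norm_ratios_le N N' C :
  (forall x, N' x <= C * N x) -> sup (norm_ratios N N') <= C.
Proof.
move=> H; apply: ge_sup => // _ [x x0 <-].
by rewrite ler_pdivrMr ?norm_on_gt0.
Qed.

Lemma inf_norm_ratios_ge N N' c :
  (forall x, c * N x <= N' x) -> c <= inf (norm_ratios N N').
Proof.
move=> H; apply: lb_le_inf => // _ [x x0 <-].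
by rewrite ler_pdivlMr ?norm_on_gt0.
Qed.

Lemma inf_norm_ratios_gt0 N N' : 0 < inf (norm_ratios N N').
Proof.
have [C C0 NC] := norm_on_comparable N' N.
apply: (@lt_le_trans _ _ C^-1); first by rewrite invr_gt0.
by apply: inf_norm_ratios_ge => x; rewrite mulrC ler_pdivrMr// mulrC.
Qed.

Lemma inf_le_sup_norm_ratios N N' :
  inf (norm_ratios N N') <= sup (norm_ratios N N').
Proof.
rewrite -(ler_pM2r (norm_on_gt0 N u_neq0)).
exact: le_trans (norm_ge_inf _ _ _) (norm_le_sup _ _ _).
Qed.

Lemma sup_norm_ratios_gt0 N N' : 0 < sup (norm_ratios N N').
Proof.
exact: lt_le_trans (inf_norm_ratios_gt0 _ _) (inf_le_sup_norm_ratios _ _).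
Qed.

Lemma norm_dist_le N N' c C : 0 < c -> (forall x, c * N x <= N' x) ->
  (forall x, N' x <= C * N x) -> norm_dist N N' <= ln (C / c).
Proof.
move=> c0 Hc HC; have M0 := sup_norm_ratios_gt0 N N'.
have m0 := inf_norm_ratios_gt0 N N'.
have MC := sup_norm_ratios_le HC; have cm := inf_norm_ratios_ge Hc.
rewrite /norm_dist ler_ln ?posrE ?divr_gt0//; last exact: lt_le_trans MC.
by rewrite ler_pM ?invr_ge0 ?(ltW M0) ?(ltW m0)// lef_pV2 ?posrE.
Qed.

End PositiveDimension.

Lemma row_dim0 : k = 0%N -> forall x : 'rV[scalar R F]_k, x = 0.
Proof. by move=> k0 x; apply/rowP => -[i lti]; have := lti; rewrite {1}k0. Qed.

Lemma norm_dist_dim0 N N' : k = 0%N -> norm_dist N N' = 0.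
Proof.
move=> k0; rewrite /norm_dist (_ : norm_ratios N N' = set0).
  by rewrite sup0 mul0r ln0.
by rewrite -subset0 => r [x /=]; rewrite (row_dim0 k0 x) eqxx.
Qed.

Lemma norm_dist_ge0 N N' : 0 <= norm_dist N N'.
Proof.
have [k0|k0] := posnP k; first by rewrite norm_dist_dim0.
by rewrite ln_ge0// ler_pdivlMr ?inf_norm_ratios_gt0// mul1r
  inf_le_sup_norm_ratios.
Qed.

Lemma norm_dist_eq0 N N' : norm_dist N N' = 0 <-> norm_equiv N N'.
Proof.
have [k0|k0] := posnP k.
  split=> _; last exact: norm_dist_dim0.
  apply/asboolP; exists 1 => // x.
  by rewrite (row_dim0 k0 x) !norm_on0 mulr0.
have M0 := sup_norm_ratios_gt0 k0 N N'.
have m0 := inf_norm_ratios_gt0 k0 N N'.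
split=> [|/asboolP[a a0 NN']].
  move=> /eqP; rewrite ln_eq0 ?divr_gt0// => /eqP /divr1_eq Mm.
  apply/asboolP; exists (sup (norm_ratios N N')) => // x.
  apply/eqP; rewrite eq_le norm_le_sup [in X in X * _]Mm norm_ge_inf.
  by [].
apply/eqP; rewrite eq_le norm_dist_ge0 andbT -ln1 -(divff (lt0r_neq0 a0)).
by apply: norm_dist_le => // x; rewrite NN'.
Qed.

Lemma norm_dist_sym N N' : norm_dist N N' = norm_dist N' N.
Proof.
have [k0|k0] := posnP k; first by rewrite !norm_dist_dim0.
suff le N1 N2 : norm_dist N2 N1 <= norm_dist N1 N2.
  by apply/eqP; rewrite eq_le !le.
have M0 := sup_norm_ratios_gt0 k0 N1 N2.
have m0 := inf_norm_ratios_gt0 k0 N1 N2.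
rewrite [leRHS](_ : _ = ln ((inf (norm_ratios N1 N2))^-1 /
  (sup (norm_ratios N1 N2))^-1)); last by rewrite invrK mulrC.
apply: norm_dist_le => // [|x|x]; first by rewrite invr_gt0.
  by rewrite mulrC ler_pdivrMr// mulrC norm_le_sup.
by rewrite mulrC ler_pdivlMr// mulrC norm_ge_inf.
Qed.

Lemma norm_dist_triangle N2 N1 N3 :
  norm_dist N1 N3 <= norm_dist N1 N2 + norm_dist N2 N3.
Proof.
have [k0|k0] := posnP k; first by rewrite !norm_dist_dim0// addr0.
have M0 := sup_norm_ratios_gt0 k0; have m0 := inf_norm_ratios_gt0 k0.
rewrite -lnM ?posrE ?divr_gt0// mulrACA -invfM.
apply: norm_dist_le => // [|x|x]; first by rewrite mulr_gt0.
  rewrite mulrAC; apply: le_trans (norm_ge_inf N2 N3 x).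
  rewrite mulrC ler_wpM2l ?(ltW (m0 _ _))//.
  exact: norm_ge_inf.
apply: le_trans (norm_le_sup N2 N3 x) _.
by rewrite mulrAC [leRHS]mulrC ler_wpM2l ?(ltW (M0 _ _))// norm_le_sup.
Qed.

Lemma norm_dist_equiv N1 N2 N1' N2' : norm_equiv N1 N1' -> norm_equiv N2 N2' ->
  norm_dist N1 N2 = norm_dist N1' N2'.
Proof.
have le N3 N4 N3' N4' : norm_equiv N3 N3' -> norm_equiv N4 N4' ->
    norm_dist N3 N4 <= norm_dist N3' N4'.
  move=> /norm_dist_eq0 e3 /norm_dist_eq0 e4.
  have := norm_dist_triangle N3' N3 N4; rewrite e3 add0r => /le_trans; apply.
  have := norm_dist_triangle N4' N3' N4.
  by rewrite (norm_dist_sym N4') e4 addr0.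
move=> e1 e2; apply/eqP; rewrite eq_le !le// norm_equiv_sym//.
Qed.

Definition norm_space_dist (p q : norm_space R F k) : R :=
  norm_dist (repr p) (repr q).

Lemma norm_space_distE N N' :
  norm_space_dist (\pi_(norm_space R F k) N) (\pi_(norm_space R F k) N') =
  norm_dist N N'.
Proof.
by apply: norm_dist_equiv; apply/eqquotP; exact: (reprK (\pi_(norm_space R F k) _)).
Qed.

Lemma norm_space_distxx p : norm_space_dist p p = 0.
Proof. exact/norm_dist_eq0/norm_equiv_refl. Qed.

Lemma norm_space_dist_eq0 p q : norm_space_dist p q = 0 -> p = q.
Proof. by move=> /norm_dist_eq0 e; rewrite -[p]reprK -[q]reprK; exact/eqquotP. Qed.

Lemma norm_space_dist_sym p q : norm_space_dist p q = norm_space_dist q p.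
Proof. exact: norm_dist_sym. Qed.

Lemma norm_space_dist_triangle q p r :
  norm_space_dist p r <= norm_space_dist p q + norm_space_dist q r.
Proof. exact: norm_dist_triangle. Qed.

HB.instance Definition _ := isMetric.Build R (norm_space R F k)
  norm_space_distxx norm_space_dist_eq0 norm_space_dist_sym
  norm_space_dist_triangle.

Lemma mdist_norm_spaceE N N' :
  mdist (\pi_(norm_space R F k) N) (\pi_(norm_space R F k) N') = norm_dist N N'.
Proof. exact: norm_space_distE. Qed.

End NormDist.

(* The axiom of [completeType], without the base point required there. *)
Definition complete_space (T : uniformType) : Prop :=
  forall G : set_system T, ProperFilter G -> cauchy G -> exists l : T, G --> l.

Definition path_connected (R : realType) (T : topologicalType) : Prop :=
  forall p q : T, exists g : R -> T,
    [/\ {within `[0, 1], continuous g}, g 0 = p & g 1 = q].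

(* Main.v *)
From HB Require Import structures.
From mathcomp Require Import all_boot all_order all_algebra generic_quotient.
From mathcomp Require Import all_classical all_reals all_analysis.
From mathcomp Require Import ring lra.
Require Import Defs.

Set Implicit Arguments.
Unset Strict Implicit.
Unset Printing Implicit Defensive.

Import Order.TTheory GRing.Theory Num.Theory.
Import numFieldNormedType.Exports.

Local Open Scope classical_set_scope.
Local Open Scope ring_scope.
Local Open Scope quotient_scope.

(** Norms exist on every F^k: with positive weights, [\sum_i w i * |x i|] is
    one, because the absolute value of F is multiplicative and subadditive.
    Besides these weighted norms, the proof rests on general arguments.

    - Banach space: any nonempty metric space embeds isometrically in the
      bounded functions on itself by Kuratowski's [p |-> d(p, .) - d(o, .)]
      ([kuratowski_isometry]), and bounded functions are complete for the sup
      norm.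
    - Completeness ([norm_space_complete]): fix a nonzero vector [e] and
      normalize each class of norms to take the value 1 at [e]. For each [x],
      the number [ln N(x)] is then a 1-Lipschitz function of the class of [N].
      Along a Cauchy filter these numbers converge uniformly in [x]
      ([cauchy_uniform_limit]); the exponential of the limit is
      positive, it inherits homogeneity and the triangle inequality because
      these are closed conditions, and uniform convergence of the logarithms is
      convergence for the metric.
    - Paths ([norm_space_path_connected]): norms form a convex set, and the
      segment [(1 - t) N0 + t N1] is a Lipschitz curve, since [N0] and [N1] are
      each bounded by a multiple of any norm of the segment.
    - For [k = 1], homogeneity determines a norm by its value at one nonzero
      vector ([norm_space_dim1]).
    - For [k > 1], giving one coordinate the weight [t] and the others the
      weight 1 yields a norm at distance at least [ln t] from the unweighted one
      ([norm_space_unbounded]). *)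

(** * The absolute value on R, C and H *)

Section ScalarAbs.
Variables (R : realType) (F : scalar_kind).
Implicit Types a b : scalar R F.

Let sqabs a : R := scalar_re (a * scalar_conj a).

(** For the quaternions, this is Euler's four-square identity. *)
Let sqabsM a b : sqabs (a * b) = sqabs a * sqabs b.
Proof.
rewrite /sqabs; case: F a b => /=
  [a b|[a a'] [b b']|[a a1 a2 a3] [b b1 b2 b3]] /=; ring.
Qed.

Let sqabs_conj a : sqabs (scalar_conj a) = sqabs a.
Proof.
rewrite /sqabs; case: F a => /= [a|[a a']|[a a1 a2 a3]] //=; ring.
Qed.

Let sqabsD a b :
  sqabs (a + b) = sqabs a + sqabs b + 2 * scalar_re (a * scalar_conj b).
Proof.
rewrite /sqabs; case: F a b => /=
  [a b|[a a'] [b b']|[a a1 a2 a3] [b b1 b2 b3]] /=; ring.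
Qed.

Let sqr_re_le a : scalar_re a ^+ 2 <= sqabs a.
Proof.
rewrite /sqabs; case: F a => /= [a|[a a']|[a a1 a2 a3]] //=;
  rewrite -?expr2 //; nra.
Qed.

Let sqabs_ge0 a : 0 <= sqabs a.
Proof. exact: le_trans (sqr_ge0 _) (sqr_re_le a). Qed.

Lemma scalar_abs_ge0 a : 0 <= scalar_abs a.
Proof. exact: sqrtr_ge0. Qed.

Lemma scalar_absM a b : scalar_abs (a * b) = scalar_abs a * scalar_abs b.
Proof. by rewrite -sqrtrM ?sqabs_ge0// -sqabsM. Qed.

Lemma scalar_abs_eq0 a : scalar_abs a = 0 -> a = 0.
Proof.
move=> /eqP; rewrite sqrtr_eq0 => /(conj (sqabs_ge0 a))/andP/le_anti/esym.
rewrite /sqabs; case: F a => /= [a|[a a']|[a a1 a2 a3]] /= aa.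
- by apply/eqP; rewrite -sqrf_eq0 expr2 aa.
- have -> : a = 0 by apply/eqP; rewrite -sqrf_eq0; apply/eqP; nra.
  have -> : a' = 0 by apply/eqP; rewrite -sqrf_eq0; apply/eqP; nra.
  by [].
- have -> : a = 0 by apply/eqP; rewrite -sqrf_eq0; apply/eqP; nra.
  have -> : a1 = 0 by apply/eqP; rewrite -sqrf_eq0; apply/eqP; nra.
  have -> : a2 = 0 by apply/eqP; rewrite -sqrf_eq0; apply/eqP; nra.
  have -> : a3 = 0 by apply/eqP; rewrite -sqrf_eq0; apply/eqP; nra.
  by [].
Qed.

Lemma scalar_abs1 : scalar_abs (1 : scalar R F) = 1.
Proof.
rewrite -[RHS](normr1 R) -(scalar_abs_of_real F 1); congr scalar_abs.
by case: F.
Qed.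

Lemma scalar_abs0 : scalar_abs (0 : scalar R F) = 0.
Proof.
rewrite -[RHS](normr0 R) -(scalar_abs_of_real F 0); congr scalar_abs.
by case: F.
Qed.

(** Squaring reduces the claim to [Re (a * conj b) <= |a| |b|]; as the real part
    of [c] is at most [|c|], multiplicativity of [|.|] gives it, without
    commutativity of F. *)
Lemma scalar_absD a b : scalar_abs (a + b) <= scalar_abs a + scalar_abs b.
Proof.
rewrite -(@ler_pXn2r _ 2) ?nnegrE ?addr_ge0 ?scalar_abs_ge0//.
rewrite sqrrD !sqr_sqrtr ?sqabs_ge0// -/(sqabs _) sqabsD.
rewrite -/(sqabs _) -/(sqabs _).
rewrite [leRHS]addrAC lerD2l -[leRHS]mulr_natl ler_pM2l//.
apply: (@le_trans _ _ (scalar_abs (a * scalar_conj b))).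
  apply: le_trans (ler_norm _) _.
  by rewrite -sqrtr_sqr /scalar_abs -/(sqabs _) ler_sqrt ?sqabs_ge0 ?sqr_re_le.
by rewrite scalar_absM /scalar_abs -/(sqabs _) -/(sqabs _) sqabs_conj.
Qed.

End ScalarAbs.

(** * Weighted l^1 norms *)

Section WeightedNorm.
Variables (R : realType) (F : scalar_kind) (k : nat).
Variables (w : 'I_k -> R) (w_gt0 : forall i, 0 < w i).

Let wnorm (x : 'rV[scalar R F]_k) := \sum_i w i * scalar_abs (x 0 i).

Let term_ge0 (x : 'rV[scalar R F]_k) i : 0 <= w i * scalar_abs (x 0 i).
Proof. by rewrite mulr_ge0 ?scalar_abs_ge0// ltW. Qed.

Let wnorm_ge0 x : 0 <= wnorm x.
Proof. by apply: sumr_ge0 => i _. Qed.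

Let wnorm_eq0 x : wnorm x = 0 <-> x = 0.
Proof.
split=> [/eqP|->]; last by apply: big1 => i _; rewrite mxE scalar_abs0 mulr0.
rewrite psumr_eq0// => /allP x0; apply/rowP => i; rewrite mxE.
apply: scalar_abs_eq0; have := x0 i (mem_index_enum _).
by rewrite /= mulf_eq0 gt_eqF//= => /eqP.
Qed.

Let wnormZ a x : wnorm (a *: x) = scalar_abs a * wnorm x.
Proof.
by rewrite mulr_sumr; apply: eq_bigr => i _; rewrite mxE scalar_absM mulrCA.
Qed.

Let wnormD x y : wnorm (x + y) <= wnorm x + wnorm y.
Proof.
rewrite -big_split; apply: ler_sum => i _ /=.
by rewrite mxE -mulrDr ler_pM2l// scalar_absD.
Qed.

Definition weighted_norm : norm_on R F k :=
  NormOn wnorm_ge0 wnorm_eq0 wnormZ wnormD.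

Lemma weighted_norm_delta i :
  weighted_norm (delta_mx 0 i) = w i.
Proof.
rewrite /= /wnorm (bigD1 i)//= big1 ?addr0 ?mxE ?eqxx ?scalar_abs1 ?mulr1//.
by move=> j ji; rewrite mxE (negPf ji) andbF scalar_abs0 mulr0.
Qed.

End WeightedNorm.

(** * Bounded functions and Kuratowski's embedding *)

(** Both completeness proofs reduce to this: the oscillation of [phi i] on a
    small set of the Cauchy filter is bounded independently of [i], so that its
    pointwise limits in the complete field R are uniform limits. *)
Lemma cauchy_uniform_limit (R : realType) (T : pseudoMetricType R) (I : Type)
    (phi : I -> T -> R) (G : set_system T) :
  ProperFilter G -> cauchy G ->
  (forall i e p q, ball p e q -> `|phi i p - phi i q| < e) ->
  exists l : I -> R, (forall i, phi i p @[p --> G] --> l i) /\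
    forall e, 0 < e -> \forall p \near G, forall i, `|phi i p - l i| <= e.
Proof.
move=> GG /cauchy_ballP cG phiL.
have cvg_phi i : exists l : R, phi i p @[p --> G] --> l.
  apply/cvg_ex/cauchy_cvgP/cauchy_ballP => e e0.
  rewrite near_map2; apply: filterS (cG _ e0) => -[p q] /=; exact: phiL.
have [l cvgl] := choice cvg_phi.
exists l; split=> // e e0.
near=> p => i.
have : `|phi i p - phi i q| @[q --> G] --> `|phi i p - l i|.
  by apply: cvg_norm; apply: cvgB => //; exact: cvg_cst.
move/cvgr_to_le; apply; near=> q.
apply/ltW/phiL; near: q; near: p; apply: nearP_dep; exact: cG.
Unshelve. all: by end_near. Qed.

Section BoundedFunctions.
Variables (R : realType) (T : Type).

Definition bounded_map : {pred T -> R} :=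
  [pred f | `[< exists M, forall t, `|f t| <= M >]].

Lemma bounded_mapP f :
  reflect (exists M, forall t, `|f t| <= M) (f \in bounded_map).
Proof. exact: asboolP. Qed.

Let bounded_submod : submod_closed bounded_map.
Proof.
split=> [|a f g].
  by apply/bounded_mapP; exists 0 => t; rewrite normr0.
move=> /bounded_mapP[M fM] /bounded_mapP[M' gM']; apply/bounded_mapP.
exists (`|a| * M + M') => t; apply: le_trans (ler_normD _ _) _.
by rewrite lerD// normrM ler_wpM2l.
Qed.

HB.instance Definition _ :=
  GRing.isSubmodClosed.Build R (T -> R) bounded_map bounded_submod.

Definition linfty : Type := {f : T -> R | f \in bounded_map}.
HB.instance Definition _ := SubChoice.on linfty.
HB.instance Definition _ := [SubChoice_isSubLmodule of linfty by <:].

Implicit Types f g : linfty.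

(** If [T] is empty, this is the supremum of the empty set, which is 0. *)
Definition linfty_norm f : R := sup (range (fun t => `|\val f t|)).

Lemma linfty_norm_ub f t : `|\val f t| <= linfty_norm f.
Proof.
apply: ub_le_sup; last by exists t.
by case: f => f /= /bounded_mapP[M fM]; exists M => _ [s _ <-].
Qed.

Lemma linfty_norm_le f M :
  0 <= M -> (forall t, `|\val f t| <= M) -> linfty_norm f <= M.
Proof.
move=> M0 fM; rewrite /linfty_norm.
have [->|/set0P f0] := eqVneq (range (fun t => `|\val f t|)) set0.
  by rewrite sup0.
by apply: ge_sup => // _ [t _ <-].
Qed.

Lemma linfty_norm_ge0 f : 0 <= linfty_norm f.
Proof.
rewrite /linfty_norm.
have [->|/set0P[_ [t _ _]]] := eqVneq (range (fun t => `|\val f t|)) set0.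
  by rewrite sup0.
exact: le_trans (normr_ge0 _) (linfty_norm_ub f t).
Qed.

Let linfty_normD f g : linfty_norm (f + g) <= linfty_norm f + linfty_norm g.
Proof.
apply: linfty_norm_le => [|t]; first by rewrite addr_ge0 ?linfty_norm_ge0.
apply: le_trans (ler_normD _ _) _.
by rewrite lerD ?linfty_norm_ub.
Qed.

Let linfty_normZ (a : R) f : linfty_norm (a *: f) = `|a| * linfty_norm f.
Proof.
have le b g : linfty_norm (b *: g) <= `|b| * linfty_norm g.
  apply: linfty_norm_le => [|t]; first by rewrite mulr_ge0 ?linfty_norm_ge0.
  by rewrite /= normrM ler_wpM2l ?linfty_norm_ub.
have [->|a0] := eqVneq a 0.
  apply/eqP; rewrite normr0 mul0r eq_le linfty_norm_ge0 andbT.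
  by apply: le_trans (le _ _) _; rewrite normr0 mul0r.
apply/eqP; rewrite eq_le le /= mulrC -ler_pdivlMr ?normr_gt0//.
by rewrite mulrC -normfV -[f in linfty_norm f](scalerK a0) le.
Qed.

Let linfty_norm_eq0 f : linfty_norm f = 0 -> f = 0.
Proof.
move=> f0; apply/val_inj/funext => t /=.
by apply/normr0_eq0/eqP; rewrite eq_le normr_ge0 andbT -f0 linfty_norm_ub.
Qed.

HB.instance Definition _ := Lmodule_isNormed.Build R linfty
  linfty_normD linfty_normZ linfty_norm_eq0.

Let linfty_complete (G : set_system linfty) :
  ProperFilter G -> cauchy G -> cvg G.
Proof.
move=> GG cG.
have phiL t e (f g : linfty) : ball f e g -> `|\val f t - \val g t| < e.
  rewrite -ball_normE /=; apply: le_lt_trans.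
  exact: (linfty_norm_ub (f - g)).
have [l [_ Gl]] := cauchy_uniform_limit GG cG phiL.
have lb : l \in bounded_map.
  have [f fl] := filter_ex (Gl _ ltr01).
  case: f fl => f /= /bounded_mapP[M fM] fl.
  apply/bounded_mapP; exists (M + 1) => t.
  rewrite -(subrK (f t) (l t)) addrC; apply: le_trans (ler_normD _ _) _.
  by rewrite lerD// distrC.
apply/cvg_ex; exists (exist _ l lb : linfty).
apply/cvgrPdist_le => e e0; near=> f.
rewrite distrC; apply: linfty_norm_le; first exact: ltW.
near: f; exact: Gl.
Unshelve. all: by end_near. Qed.

HB.instance Definition _ := Uniform_isComplete.Build linfty linfty_complete.

End BoundedFunctions.

Section Kuratowski.
Variables (R : realType) (T : metricType R) (o : T).

Let mdist_diff (p q t : T) : `|mdist p t - mdist q t| <= mdist p q.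
Proof.
have := metric_triangle q p t; have := metric_triangle p q t.
rewrite (metric_sym q p) => *; rewrite ler_norml; apply/andP; split; lra.
Qed.

Let kuratowski_bounded p :
  (fun t => mdist p t - mdist o t) \in @bounded_map R T.
Proof. by apply/bounded_mapP; exists (mdist p o) => t; exact: mdist_diff. Qed.

(** Subtracting the distance to the base point [o] makes the distance function
    bounded, by the triangle inequality, without changing differences. *)
Definition kuratowski p : linfty R T :=
  exist _ (fun t => mdist p t - mdist o t) (kuratowski_bounded p).

(** The sup of [|d(p, t) - d(q, t)|] is at most [d(p, q)] by the triangle
    inequality, and is reached at [t = q]. *)
Lemma kuratowski_isometry p q : `|kuratowski p - kuratowski q| = mdist p q.
Proof.
have E t : \val (kuratowski p - kuratowski q) t = mdist p t - mdist q t.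
  have -> : \val (kuratowski p - kuratowski q) t =
    (mdist p t - mdist o t) - (mdist q t - mdist o t) by [].
  by ring.
apply/eqP; rewrite eq_le; apply/andP; split.
  by apply: linfty_norm_le => [|t]; rewrite ?mdist_ge0// E mdist_diff.
apply: le_trans (linfty_norm_ub _ q).
by rewrite E mdistxx subr0 ler_norm.
Qed.

End Kuratowski.

(** * Completeness *)

Lemma ones_neq0 (R : nzRingType) k :
  (0 < k)%N -> const_mx 1 != 0 :> 'rV[R]_k.
Proof.
move=> k_gt0; apply/eqP => /rowP/(_ (Ordinal k_gt0)); rewrite !mxE => /eqP.
by rewrite oner_eq0.
Qed.

Section NormSpace.
Variables (R : realType) (F : scalar_kind) (k : nat).
Hypothesis k_gt0 : (0 < k)%N.
Implicit Types N : norm_on R F k.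

Let e : 'rV[scalar R F]_k := const_mx 1.

Let e_neq0 : e != 0. Proof. exact: ones_neq0. Qed.

(** The distance is the oscillation of [ln N' - ln N] on nonzero vectors. *)
Lemma norm_dist_quotient N N' x y : x != 0 -> y != 0 ->
  ln (N' x / N x) - ln (N' y / N y) <= norm_dist N N'.
Proof.
move=> x0 y0; have m0 := inf_norm_ratios_gt0 k_gt0 N N'.
have M0 := sup_norm_ratios_gt0 k_gt0 N N'.
have gt0 := norm_on_gt0.
rewrite /norm_dist [leRHS]ln_div ?posrE// lerB// ler_ln ?posrE ?divr_gt0 ?gt0//.
  by rewrite ler_pdivrMr ?gt0// norm_le_sup.
by rewrite ler_pdivlMr ?gt0// norm_ge_inf.
Qed.

(** A class has no preferred norm; dividing by the value at [e] makes the value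
    at [x] independent of the representative. *)
Definition normalized x (p : norm_space R F k) : R := repr p x / repr p e.

Definition log_profile x p : R := ln (normalized x p).

(** The two profiles at [x] differ by the difference of [ln N' - ln N] between
    [x] and [e], and thus by at most its oscillation. *)
Lemma log_profile_lipschitz x p q :
  `|log_profile x p - log_profile x q| <= mdist p q.
Proof.
have [->|x0] := eqVneq x 0.
  by rewrite /log_profile /normalized !norm_on0 !mul0r subrr normr0 mdist_ge0.
have gt0 := norm_on_gt0.
have E r s : log_profile x s - log_profile x r <= mdist r s.
  apply: le_trans (norm_dist_quotient (repr r) (repr s) x0 e_neq0).
  by rewrite /log_profile /normalized !ln_div ?posrE ?gt0//; lra.
have := E p q; have := E q p; rewrite (metric_sym q p) => *.
by rewrite ler_norml; apply/andP; split; lra.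
Qed.

Lemma norm_space_complete : complete_space (norm_space R F k).
Proof.
move=> G GG cG.
have phiL x r p q : ball p r q -> `|log_profile x p - log_profile x q| < r.
  by rewrite ballEmdist /=; apply: le_lt_trans; exact: log_profile_lipschitz.
have [l [cvgl unif]] := cauchy_uniform_limit GG cG phiL.
(* At 0 the logarithm is meaningless: its value there is the convention
   [ln 0 = 0], so that the limit norm must be set to 0 by hand. *)
pose L x : R := if x == 0 then 0 else expR (l x).
have normalizedE p x : x != 0 -> expR (log_profile x p) = normalized x p.
  by move=> x0; rewrite lnK// posrE divr_gt0 ?norm_on_gt0.
have cvgL x : normalized x p @[p --> G] --> L x.
  rewrite /L; have [->|x0] := eqVneq x 0.
    by under eq_fun do rewrite /normalized norm_on0 mul0r; exact: cvg_cst.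
  under eq_fun do rewrite -normalizedE//.
  exact: (continuous_cvg _ (@continuous_expR R _)).
have L_ge0 x : 0 <= L x by rewrite /L; case: ifP => // _; exact: expR_ge0.
have L_eq0 x : L x = 0 <-> x = 0.
  rewrite /L; split=> [|->]; last by rewrite eqxx.
  by case: eqP => // _ /eqP; rewrite gt_eqF ?expR_gt0.
have LZ a x : L (a *: x) = scalar_abs a * L x.
  apply: (cvg_unique _ (cvgL (a *: x))) => //.
  have nZ p : normalized (a *: x) p = scalar_abs a * normalized x p.
    by rewrite /normalized norm_onZ mulrA.
  rewrite /=; under eq_fun do rewrite nZ.
  by apply: cvgM => //; exact: cvg_cst.
have LD x y : L (x + y) <= L x + L y.
  apply: (ler_cvg_to (cvgL (x + y)) (cvgD (cvgL x) (cvgL y))).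
  near=> p; rewrite /= /normalized -mulrDl ler_pM2r ?norm_onD//.
  by rewrite invr_gt0 norm_on_gt0.
pose N := NormOn L_ge0 L_eq0 LZ LD.
exists (\pi_(norm_space R F k) N).
apply/metricType_numDomainType.fcvgrPdist_lt => r r0.
(* Logarithms at most r / 4 apart on either side oscillate by at most r / 2, and
   the oscillation is the distance. *)
have r4 : 0 < r / 4 by lra.
near=> p.
have pl : forall x, `|log_profile x p - l x| <= r / 4 by near: p; exact: unif.
rewrite metric_sym -[p]reprK mdist_norm_spaceE.
set P := repr p; have Pe : 0 < P e by exact: norm_on_gt0.
pose c := expR (- (r / 4)) / P e; pose C := expR (r / 4) / P e.
apply: (@le_lt_trans _ _ (ln (C / c))).
  have bounds x : c * P x <= L x <= C * P x.
    rewrite /c /C.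
    rewrite mulrAC -mulrA [X in _ <= _ <= X]mulrAC -[X in _ <= _ <= X]mulrA /L.
    have [->|x0] := eqVneq x 0; first by rewrite norm_on0 mul0r !mulr0 lexx.
    rewrite -/(normalized x p) -normalizedE// -!expRD !ler_expR.
    by have := pl x; rewrite ler_norml; lra.
  apply: norm_dist_le => //; first by rewrite divr_gt0 ?expR_gt0.
    by move=> x; case/andP: (bounds x).
  by move=> x; case/andP: (bounds x).
rewrite /c /C invf_div mulrA divfK ?gt_eqF// -expRN opprK -expRD expRK; lra.
Unshelve. all: by end_near. Qed.

(** * Path-connectedness *)

(** With the relative error [r] measured against both norms, [N' <= (1 + r) N]
    and [N <= (1 + r) N'], so that the distance is at most [2 ln (1 + r)]. *)
Lemma norm_dist_close N N' (r : R) : 0 <= r ->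
  (forall x, `|N x - N' x| <= r * N x) ->
  (forall x, `|N x - N' x| <= r * N' x) ->
  norm_dist N N' <= 2 * r.
Proof.
move=> r0 close close'; have r1 : 0 < 1 + r by lra.
apply: (@le_trans _ _ (ln ((1 + r) / (1 + r)^-1))).
  apply: norm_dist_le => // [|x|x]; first by rewrite invr_gt0.
    rewrite mulrC ler_pdivrMr//.
    by have := close' x; rewrite ler_norml; lra.
  by have := close x; rewrite ler_norml; lra.
rewrite invrK lnM ?posrE//; have rN1 : -1 < r by lra.
by have := le_ln1Dx rN1; lra.
Qed.

End NormSpace.

Section Segment.
Variables (R : realType) (F : scalar_kind) (k : nat).
Variables (N0 N1 : norm_on R F k).

(** Clamping the parameter to [[0, 1]] makes the segment a curve defined on all
    of R, whose points are norms. *)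
Let clamp (t : R) : R := Num.max 0 (Num.min t 1).

Let clampP t : [\/ t <= 0 /\ clamp t = 0, 1 <= t /\ clamp t = 1
  | (0 <= t /\ t <= 1) /\ clamp t = t].
Proof.
rewrite /clamp; case: (lerP t 1) => t1.
  by case: (lerP 0 t) => t0; [apply: Or33|apply: Or31]; split=> //; lra.
by rewrite max_r ?ler01//; apply: Or32; split=> //; lra.
Qed.

Let clamp01 t : 0 <= clamp t <= 1.
Proof.
by case: (clampP t) => [[? ->]|[? ->]|[[? ?] ->]]; apply/andP; split; lra.
Qed.

Let clamp_lipschitz s t : `|clamp s - clamp t| <= `|s - t|.
Proof.
have st := ler_norm (s - t); have := ler_norm (t - s); rewrite distrC => ts.
rewrite ler_norml; apply/andP; split.
all: case: (clampP s) => [[? ->]|[? ->]|[[? ?] ->]].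
all: by case: (clampP t) => [[? ->]|[? ->]|[[? ?] ->]]; lra.
Qed.

Let snorm t x := (1 - clamp t) * N0 x + clamp t * N1 x.

Let snorm_ge0 t x : 0 <= snorm t x.
Proof.
have /andP[? ?] := clamp01 t.
by rewrite addr_ge0// mulr_ge0 ?norm_on_ge0// subr_ge0.
Qed.

Let snorm_eq0 t x : snorm t x = 0 <-> x = 0.
Proof.
split=> [|->]; last by rewrite /snorm !norm_on0 !mulr0 addr0.
move=> s0; apply: contra_eq (erefl (0 : R)) => x0.
have := norm_on_gt0 N0 x0; have := norm_on_gt0 N1 x0; have := clamp01 t.
move: s0; rewrite /snorm => ? ? ? ?; nra.
Qed.

Let snormZ t a x : snorm t (a *: x) = scalar_abs a * snorm t x.
Proof. by rewrite /snorm !norm_onZ; ring. Qed.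

Let snormD t x y : snorm t (x + y) <= snorm t x + snorm t y.
Proof.
have := clamp01 t; have := norm_onD N0 x y; have := norm_onD N1 x y.
rewrite /snorm => ? ? ?; nra.
Qed.

Definition segment_norm t : norm_on R F k :=
  NormOn (snorm_ge0 t) (snorm_eq0 t) (snormZ t) (snormD t).

Lemma segment_norm0 : segment_norm 0 =1 N0.
Proof.
move=> x; rewrite /= /snorm /clamp min_l ?ler01// max_l//.
by rewrite subr0 mul1r mul0r addr0.
Qed.

Lemma segment_norm1 : segment_norm 1 =1 N1.
Proof.
move=> x; rewrite /= /snorm /clamp min_l// max_r ?ler01//.
by rewrite subrr mul1r mul0r add0r.
Qed.

(** Two norms of the segment differ by a multiple of [N1 - N0], with a factor of
    absolute value at most [|s - t|]; and [N0] and [N1] are both bounded by a multiple of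
    [segment_norm s], uniformly in [s], because each is comparable to the
    other. *)
Lemma segment_norm_lipschitz : exists2 C, 0 <= C & forall s t x,
  `|segment_norm s x - segment_norm t x| <= C * `|s - t| * segment_norm s x.
Proof.
have [C C0 NC] := norm_on_comparable N0 N1.
have [D D0 ND] := norm_on_comparable N1 N0.
exists (C + D + 1) => [|s t x]; first lra.
have -> : segment_norm s x - segment_norm t x =
    (clamp s - clamp t) * (N1 x - N0 x).
  by rewrite /= /snorm; ring.
rewrite normrM mulrAC mulrC ler_pM ?clamp_lipschitz//.
have /andP[c0 c1] := clamp01 s.
have := norm_on_ge0 N0 x; have := norm_on_ge0 N1 x.
have := NC x; have := ND x.
rewrite /= /snorm; move: (clamp s) c0 c1 (N0 x) (N1 x).
move=> c c0 c1 a b aDb bCa b0 a0.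
(* Each of a and b is the sum of its shares 1 - c and c; the share that is not
   in the convex combination is bounded by comparability. *)
have u0 : 0 <= (1 - c) * a by rewrite mulr_ge0// subr_ge0.
have v0 : 0 <= c * b by rewrite mulr_ge0.
have au : a <= (1 - c) * a + D * (c * b) by nra.
have bu : b <= C * ((1 - c) * a) + c * b by nra.
move: ((1 - c) * a) (c * b) u0 v0 au bu => u v u0 v0 au bu.
have Cu : 0 <= C * u by rewrite mulr_ge0// ltW.
have Cv : 0 <= C * v by rewrite mulr_ge0// ltW.
have Du : 0 <= D * u by rewrite mulr_ge0// ltW.
have Dv : 0 <= D * v by rewrite mulr_ge0// ltW.
by rewrite ler_norml; apply/andP; split; lra.
Qed.

End Segment.

Lemma norm_space_path_connected (R : realType) (F : scalar_kind) (k : nat) :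
  (0 < k)%N -> path_connected R (norm_space R F k).
Proof.
move=> k_gt0 p q; pose N := segment_norm (repr p) (repr q).
have same (N1 N2 : norm_on R F k) : N1 =1 N2 ->
    \pi_(norm_space R F k) N1 = \pi_(norm_space R F k) N2.
  move=> N12; apply/eqquotP/asboolP; exists 1 => // x.
  by rewrite mul1r N12.
exists (fun t => \pi_(norm_space R F k) (N t)); split.
- apply: continuous_subspaceT => s.
  have [C C0 NL] := segment_norm_lipschitz (repr p) (repr q).
  apply/metricType_numDomainType.cvgrPdist_lt => r r0.
  (* 2 C is a Lipschitz constant; adding 1 avoids dividing by 0. *)
  have rC : 0 < r / (2 * C + 1) by rewrite divr_gt0//; lra.
  near=> t.
  have st : `|s - t| < r / (2 * C + 1).
    by near: t; apply: cvgr_dist_lt => //; exact: cvg_id.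
  rewrite mdist_norm_spaceE.
  apply: (@le_lt_trans _ _ (2 * (C * `|s - t|))).
    apply: norm_dist_close => //; first by rewrite mulr_ge0.
    by move=> x; rewrite distrC [`|s - t|]distrC; exact: NL.
  move: st; rewrite ltr_pdivlMr; last lra.
  by have := normr_ge0 (s - t); lra.
- by rewrite -[RHS]reprK; apply/same/segment_norm0.
- by rewrite -[RHS]reprK; apply/same/segment_norm1.
Unshelve. all: by end_near. Qed.

(** * Dimension one and unboundedness *)

Lemma norm_space_dim1 (R : realType) (F : scalar_kind)
    (p q : norm_space R F 1) :
  p = q.
Proof.
rewrite -[p]reprK -[q]reprK; apply/eqquotP/asboolP.
move: (repr p) (repr q) => N N'.
pose e : 'rV[scalar R F]_1 := const_mx 1.
have e0 : e != 0 by exact: ones_neq0.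
exists (N' e / N e); first by rewrite divr_gt0 ?norm_on_gt0.
move=> x; have -> : x = x 0 0 *: e.
  by apply/rowP => i; rewrite (ord1 i) !mxE mulr1.
rewrite !norm_onZ mulrCA divfK// gt_eqF// norm_on_gt0//.
Qed.

(** For a weight [t] on the first coordinate, the ratio to the unweighted norm
    is [t] at the first basis vector and 1 at the second, so that the distance
    is at least [ln t]. *)
Lemma norm_space_unbounded (R : realType) (F : scalar_kind) (k : nat) :
  (1 < k)%N -> ~ exists C : R, forall p q : norm_space R F k, mdist p q <= C.
Proof.
move=> k_gt1 [C distC].
pose i0 := Ordinal (ltnW k_gt1); pose i1 := Ordinal k_gt1.
pose w (t : R) (i : 'I_k) := if i == i0 then t else 1.
have w_gt0 t : 0 < t -> forall i, 0 < w t i by rewrite /w => t0 i; case: ifP.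
pose N := @weighted_norm R F k (w 1) (w_gt0 1 ltr01).
pose N' := @weighted_norm R F k (w (expR (C + 1))) (w_gt0 _ (expR_gt0 (C + 1))).
have delta_neq0 i : delta_mx 0 i != 0 :> 'rV[scalar R F]_k.
  by apply/eqP => /rowP/(_ i)/eqP; rewrite !mxE !eqxx oner_eq0.
have := distC (\pi_(norm_space R F k) N) (\pi_(norm_space R F k) N').
rewrite mdist_norm_spaceE.
have := norm_dist_quotient (ltnW k_gt1) N N' (delta_neq0 i0) (delta_neq0 i1).
rewrite !weighted_norm_delta /w !eqxx /= !divr1 ln1 expRK; lra.
Qed.

Theorem theorem1p8 (R : realType) (F : scalar_kind) (k : nat)
    (k_ge1 : (1 <= k)%N) :
  [/\ exists (B : completeNormedModType R) (f : norm_space R F k -> B),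
        forall p q : norm_space R F k, `|f p - f q| = mdist p q,
      complete_space (norm_space R F k),
      path_connected R (norm_space R F k),
      k = 1%N -> exists p : norm_space R F k, [set: norm_space R F k] = [set p]
    & (1 < k)%N ->
      ~ exists C : R, forall p q : norm_space R F k, mdist p q <= C].
Proof.
pose o := \pi_(norm_space R F k) (@weighted_norm R F k (fun=> 1) (fun=> ltr01)).
split.
- exists (linfty R (norm_space R F k)), (kuratowski o).
  exact: kuratowski_isometry.
- exact: norm_space_complete.
- exact: norm_space_path_connected.
- move=> k1; exists o; apply/seteqP; split=> // p _ /=.
  by move: o p; rewrite k1 => o p; exact: norm_space_dim1.
- exact: norm_space_unbounded.
Qed.
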